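(* Let $U$ be an $n$-qubit unitary with noiseless unitary channel $\mathcal{U}=U(\cdot)U^\dagger$, and let $\Lambda(\mathcal{U})=\Lambda(\gamma)\circ\mathcal{U}$ be the corresponding noisy channel, where $\Lambda(\gamma)$ is the depolarizing channel with strength $\gamma$, $$\Lambda(\gamma):\rho\mapsto(1-\gamma)\rho+\gamma\operatorname{Tr}(\rho)\frac{\mathbb{I}}{d},\qquad d=2^n .$$ Then, given an initial (possibly loose) upper bound $\gamma\le\gamma_u$, for every $\epsilon$ with $0<\epsilon\le1-\gamma_u$ there exists a method that characterizes the noise, i.e. that produces an interval $[l,u]$ with $$\|\mathcal{U}-\Lambda(\mathcal{U})\|_\diamond\in[l,u],\qquad u-l\le\epsilon,$$ using a single query to $\mathsf{2QPStat}_{\Lambda(\mathcal{U})}$ with tolerance $\tau=\Theta((1-\gamma_u)\epsilon)$.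
   Context: $\mathcal{S}_M$ is the set of density matrices on $\mathbb{C}^M$. The diamond norm of a map $\mathcal{E}$ on $N\times N$ matrices is $\|\mathcal{E}\|_\diamond=\max_{\rho\in\mathcal{S}_{N^2}}\|(\mathcal{E}\otimes\mathcal{I})(\rho)\|_1$, with $\mathcal{I}$ the identity map and $\|\cdot\|_1$ the Schatten 1-norm. The depolarizing strength satisfies $\gamma\in[0,1]$ and is unknown to the method. Oracle: for a quantum channel $\mathcal{E}:\mathcal{S}_N\to\mathcal{S}_N$, the two-copy oracle $\mathsf{2QPStat}_{\mathcal{E}}$ takes as input a Hermitian observable $O$ on $\mathbb{C}^{N}\otimes\mathbb{C}^N$ with $\|O\|_\infty\le1$ (operator norm), a state $\rho\in\mathcal{S}_{N^2}$ (possibly entangled across the two registers) and a tolerance $\tau>0$, and returns some $\alpha\in\mathbb{R}$ with $|\alpha-\operatorname{Tr}(O\,\mathcal{E}^{\otimes2}(\rho))|\le\tau$ (any such value may be returned). Here $N=d=2^n$. The $\Theta$ hides absolute constants. *)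

(* Defs.v *)
(* Complex numbers are R[i] over an arbitrary R : realType.
   Matrices act on column vectors.  C^m (x) C^n is C^(m * n), with the basis
   vector e_i (x) e_k at position mxtens_index (i, k). *)
From HB Require Import structures.
From mathcomp Require Import all_boot all_order all_algebra.
From mathcomp Require Import boolp classical_sets reals.
From mathcomp Require Import complex mxtens.

Set Implicit Arguments.
Unset Strict Implicit.
Unset Printing Implicit Defensive.

Import Order.TTheory GRing.Theory Num.Theory.

Local Open Scope classical_set_scope.
Local Open Scope ring_scope.
Local Open Scope sesquilinear_scope.
Local Open Scope complex_scope.

Section Matrices.
Variable R : realType.
Local Notation C := R[i].

(* In R[i], 0 <= z means that z is real and nonnegative. *)
Definition density_matrix (m : nat) (rho : 'M[C]_m) : Prop :=
  [/\ rho \is hermsymmx,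
      forall v : 'cV[C]_m, 0 <= (v^t* *m rho *m v) 0 0 &
      \tr rho = 1].

Definition euclidean_norm (m : nat) (v : 'cV[C]_m) : R :=
  Num.sqrt (\sum_(i < m) ComplexField.Normc.normc (v i 0) ^+ 2).

Definition operator_norm (m : nat) (A : 'M[C]_m) : R :=
  sup [set euclidean_norm (A *m v) | v in [set v : 'cV[C]_m |
    euclidean_norm v = 1]].

(* The sum of the singular values: the entries of spectral_diag (A^t* *m A)
   are the eigenvalues of A^t* *m A, listed with multiplicity, since that
   matrix is normal. *)
Definition trace_norm (m : nat) (A : 'M[C]_m) : R :=
  \sum_(i < m) Num.sqrt (complex.Re (spectral_diag (A^t* *m A) 0 i)).

End Matrices.

Section Channels.
Variable R : realType.
Local Notation C := R[i].

(* E (x) F, expanded on the matrix units e_i e_j^* (x) e_k e_l^*. *)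
Definition tens_map (m n : nat) (E : {linear 'M[C]_m -> 'M[C]_m})
    (F : {linear 'M[C]_n -> 'M[C]_n}) (X : 'M[C]_(m * n)) : 'M[C]_(m * n) :=
  \sum_(i < m) \sum_(j < m) \sum_(k < n) \sum_(l < n)
    X (mxtens_index (i, k)) (mxtens_index (j, l)) *:
      (E (delta_mx i j) *t F (delta_mx k l)).

(* The maximum is rendered as a supremum: the set of density matrices is
   compact and the function being maximized is continuous. *)
Definition diamond_norm (m : nat) (E : {linear 'M[C]_m -> 'M[C]_m}) : R :=
  sup [set trace_norm (tens_map E idfun rho) | rho in
    [set rho : 'M[C]_(m * m) | density_matrix rho]].

Definition unitary_channel (m : nat) (U X : 'M[C]_m) : 'M[C]_m :=
  U *m X *m U^t*.

Fact unitary_channel_is_linear (m : nat) (U : 'M[C]_m) :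
  linear (unitary_channel U).
Proof.
by move=> a X Y; rewrite /unitary_channel mulmxDr mulmxDl -scalemxAr -scalemxAl.
Qed.

HB.instance Definition _ (m : nat) (U : 'M[C]_m) :=
  GRing.isLinear.Build C 'M[C]_m 'M[C]_m *:%R (unitary_channel U)
    (@unitary_channel_is_linear m U).

Definition depolarizing (m : nat) (gamma : R) (X : 'M[C]_m) : 'M[C]_m :=
  (1 - gamma)%:C *: X + (gamma%:C * \tr X) *: (m%:R^-1 *: 1%:M).

Fact depolarizing_is_linear (m : nat) (gamma : R) :
  linear (@depolarizing m gamma).
Proof.
move=> a X Y; rewrite /depolarizing mxtraceD mxtraceZ mulrDr !scalerDr scalerDl.
by rewrite !scalerA mulrCA addrACA (mulrC a (1 - gamma)%:C) !mulrA.
Qed.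

HB.instance Definition _ (m : nat) (gamma : R) :=
  GRing.isLinear.Build C 'M[C]_m 'M[C]_m *:%R (@depolarizing m gamma)
    (@depolarizing_is_linear m gamma).

Definition noisy_channel (m : nat) (gamma : R) (U : 'M[C]_m) :
    {linear 'M[C]_m -> 'M[C]_m} :=
  @depolarizing m gamma \o unitary_channel U.

(* The inputs accepted by the two-copy oracle on an m-dimensional system. *)
Definition admissible_query (m : nat) (O rho : 'M[C]_(m * m)) (tau : R) : Prop :=
  [/\ O \is hermsymmx, operator_norm O <= 1, density_matrix rho & 0 < tau].

(* The oracle is a relation: alpha is one of its possible answers. *)
Definition qpstat2 (m : nat) (E : {linear 'M[C]_m -> 'M[C]_m})
    (O rho : 'M[C]_(m * m)) (tau alpha : R) : Prop :=
  `|alpha%:C - \tr (O *m tens_map E E rho)| <= tau%:C.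

End Channels.

(* Main.v *)
(* Conjugate a pure state psi by U to get P.  On two copies of psi the noisy
   channel gives P (x) P the expectation (1 - gamma (1 - 1/d)) ^ 2, a quantity
   whose square root is at least 1 - gamma_u, so an answer within tau determines
   gamma up to O(tau / (1 - gamma_u)).  The diamond distance is gamma * D, where D
   does not depend on gamma, and D <= 2: each output of the channel difference is
   a difference of two positive semidefinite matrices of trace 1, by Kraus
   decompositions. *)
Require Import Defs.
From mathcomp Require Import all_boot all_order all_algebra.
From mathcomp Require Import boolp classical_sets reals.
From mathcomp Require Import complex mxtens.
From mathcomp Require Import ring lra.

Import Order.TTheory GRing.Theory Num.Theory.
Local Open Scope ring_scope.
Local Open Scope sesquilinear_scope.
Local Open Scope complex_scope.

Set Implicit Arguments.
Unset Strict Implicit.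

(** * Suprema, adjoints and traces of tensor products *)

(** The sign condition on [b] covers the empty set, whose [sup] is 0 by convention. *)
Lemma sup_le (R : realType) (S : set R) (b : R) :
  0 <= b -> ubound S b -> sup S <= b.
Proof.
move=> b0 Sb; have [S0|S0] := pselect (nonempty S); first exact: sup_le_ub.
by rewrite sup_out // => -[].
Qed.

Lemma trmxC_mul (C : numClosedFieldType) m n p (A : 'M[C]_(m, n)) (B : 'M_(n, p)) :
  (A *m B)^t* = B^t* *m A^t*.
Proof. by rewrite trmx_mul map_mxM. Qed.

Lemma trmxC_tens (C : numClosedFieldType) m n p q (A : 'M[C]_(m, n)) (B : 'M_(p, q)) :
  (A *t B)^t* = A^t* *t B^t*.
Proof. by rewrite trmx_tens map_mxT. Qed.

Lemma mxtrace_tens (C : comPzRingType) m n (A : 'M[C]_m) (B : 'M_n) :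
  \tr (A *t B) = \tr A * \tr B.
Proof. by rewrite /mxtrace mulr_sum; apply: eq_bigr => i _; rewrite mxE. Qed.

Lemma hermsymmxP (C : numClosedFieldType) n (A : 'M[C]_n) :
  reflect (A^t* = A) (A \is hermsymmx).
Proof.
by rewrite is_hermitianmxE expr0 scale1r eq_sym; exact: eqP.
Qed.

Lemma trmxC_delta (C : numClosedFieldType) m n i j :
  (delta_mx i j : 'M[C]_(m, n))^t* = delta_mx j i.
Proof. by rewrite trmx_delta map_delta_mx. Qed.

(** * Positive semidefinite matrices *)

(** These are the conditions of [density_matrix] without the normalization of the trace, so that
    they survive sums and scalings. *)
Definition psdmx (C : numClosedFieldType) n (A : 'M[C]_n) : Prop :=
  A^t* = A /\ forall v : 'cV[C]_n, 0 <= (v^t* *m A *m v) 0 0.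

Lemma psdmx_gram (C : numClosedFieldType) m n (K : 'M[C]_(m, n)) :
  psdmx (K *m K^t*).
Proof.
split=> [|v]; first by rewrite trmxC_mul trmxCK.
rewrite mulmxA -mulmxA -[v^t* *m K]trmxCK trmxC_mul trmxCK mxE sumr_ge0 // => i _.
by rewrite !mxE mulrC mul_conjC_ge0.
Qed.

Lemma psdmx_conj (C : numClosedFieldType) m n (K : 'M[C]_(m, n)) (A : 'M_n) :
  psdmx A -> psdmx (K *m A *m K^t*).
Proof.
move=> [hA pA]; split=> [|v]; first by rewrite !trmxC_mul trmxCK hA mulmxA.
have -> : v^t* *m (K *m A *m K^t*) *m v = (K^t* *m v)^t* *m A *m (K^t* *m v).
  by rewrite trmxC_mul trmxCK !mulmxA.
exact: pA.
Qed.

Lemma psdmxZ (C : numClosedFieldType) n c (A : 'M[C]_n) :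
  0 <= c -> psdmx A -> psdmx (c *: A).
Proof.
move=> c0 [hA pA]; split=> [|v].
  by rewrite linearZ /= map_mxZ hA; congr (_ *: _); exact/CrealP/ger0_real.
by rewrite -scalemxAr -scalemxAl mxE mulr_ge0.
Qed.

Lemma psdmx_sum (C : numClosedFieldType) n (I : finType) (A : I -> 'M[C]_n) :
  (forall i, psdmx (A i)) -> psdmx (\sum_i A i).
Proof.
move=> pA; split=> [|v].
  rewrite linear_sum raddf_sum; apply: eq_bigr => i _.
  by case: (pA i).
rewrite mulmx_sumr mulmx_suml summxE sumr_ge0 // => i _.
by case: (pA i).
Qed.

Lemma psdmx_diag_ge0 (C : numClosedFieldType) n (A : 'M[C]_n) i :
  psdmx A -> 0 <= A i i.
Proof.
move=> [_ /(_ (delta_mx i 0))]; rewrite trmxC_delta -rowE.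
by rewrite -colE !mxE.
Qed.

(** * Spectra and the trace norm *)

Lemma char_poly_conj (F : fieldType) n (V A : 'M[F]_n) :
  V \in unitmx -> char_poly (invmx V *m A *m V) = char_poly A.
Proof.
move=> uV; pose W := map_mx polyC V; pose W' := map_mx polyC (invmx V).
have WW : W' *m W = 1%:M by rewrite -map_mxM mulVmx // map_mx1.
have -> : char_poly (invmx V *m A *m V) = \det (W' *m char_poly_mx A *m W).
  rewrite /char_poly /char_poly_mx mulmxBr mulmxBl -!map_mxM; congr (\det (_ - _)).
  by rewrite mul_mx_scalar -scalemxAl WW scale_scalar_mx mulr1.
by rewrite !det_mulmx mulrAC -det_mulmx WW det1 mul1r.
Qed.

(** Both diagonal forms of [A] have its characteristic polynomial, and the linear factors of that
    polynomial are unique up to order. Hence [trace_norm] can be computed from any unitary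
    diagonalization, not only from the one chosen by [spectral_diag]. *)
Lemma sum_spectral_diag (C : numClosedFieldType) (T : nmodType) n
    (A V : 'M[C]_n) (s : 'rV_n) (f : C -> T) :
  V \is unitarymx -> A = invmx V *m diag_mx s *m V ->
  \sum_i f (spectral_diag A 0 i) = \sum_i f (s 0 i).
Proof.
move=> uV dA; have nA : A \is normalmx.
  by apply/orthomx_spectral_subproof; exists (V, s).
have /orthomx_spectralP eA := nA.
have char_diag (t : 'rV[C]_n) :
    char_poly (diag_mx t) = \prod_(x <- [seq t 0 i | i : 'I_n]) ('X - x%:P).
  rewrite char_poly_trig ?diag_mx_is_trig // big_map big_enum /=.
  by apply: eq_bigr => i _; rewrite mxE eqxx.
have : char_poly (diag_mx (spectral_diag A)) = char_poly (diag_mx s).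
  rewrite -(char_poly_conj (diag_mx s) (unitarymx_unit uV)) -dA.
  by rewrite [in RHS]eA char_poly_conj // spectral_unit.
rewrite !char_diag => /prod_XsubC_eq sum_eq.
transitivity (\sum_(x <- [seq spectral_diag A 0 i | i : 'I_n]) f x).
  by rewrite big_map big_enum.
by rewrite (perm_big _ sum_eq) big_map big_enum.
Qed.

(** Scaling [A] by [t] multiplies the eigenvalues of [A^t* *m A] by [t ^+ 2] and keeps the
    eigenvectors; the square root then returns the factor [t]. *)
Lemma trace_normZ (R : realType) n (t : R) (A : 'M[R[i]]_n) :
  0 <= t -> trace_norm (t%:C *: A) = t * trace_norm A.
Proof.
move=> t0; set B := A^t* *m A.
have nB : B \is normalmx.
  by apply/hermitian_normalmx/hermsymmxP; rewrite trmxC_mul trmxCK.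
have /orthomx_spectralP eB := nB.
have eAA : (t%:C *: A)^t* *m (t%:C *: A) = invmx (spectralmx B)
    *m diag_mx ((t ^+ 2)%:C *: spectral_diag B) *m spectralmx B.
  have -> : (t%:C *: A)^t* = t%:C *: A^t*.
    by apply/matrixP => i j; rewrite !mxE rmorphM; congr (_ * _); exact: conjc_real.
  rewrite -scalemxAl -scalemxAr scalerA -rmorphM -expr2 linearZ /=.
  by rewrite -scalemxAr -scalemxAl -eB.
rewrite /trace_norm.
rewrite (sum_spectral_diag (fun z => Num.sqrt (complex.Re z))
  (spectral_unitarymx B) eAA).
rewrite mulr_sumr; apply: eq_bigr => i _; rewrite mxE -/B.
case: (spectral_diag B 0 i) => x y /=; rewrite mul0r subr0.
by rewrite sqrtrM ?sqr_ge0 // sqrtr_sqr ger0_norm.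
Qed.

Lemma conj_diag_mx_sqr (F : fieldType) n (V : 'M[F]_n) (d : 'rV_n) : V \in unitmx ->
  (invmx V *m diag_mx d *m V) *m (invmx V *m diag_mx d *m V) =
  invmx V *m diag_mx (\row_i d 0 i ^+ 2) *m V.
Proof.
move=> uV; rewrite !mulmxA mulmxK // -[_ *m diag_mx d *m diag_mx d]mulmxA.
congr (_ *m _ *m _).
by rewrite mulmx_diag; congr diag_mx; apply/rowP => i; rewrite !mxE.
Qed.

Lemma Re_ge0 (R : realType) (z : R[i]) : 0 <= z -> 0 <= complex.Re z.
Proof. by rewrite lecE => /andP[]. Qed.

(** In an orthonormal eigenbasis of [P - Q], each eigenvalue is a diagonal entry of [P] minus one of
    [Q]. Both are nonnegative, so its absolute value is at most their sum, and these sums add up to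
    the two traces. *)
Lemma trace_norm_psdB (R : realType) n (P Q : 'M[R[i]]_n) :
  psdmx P -> psdmx Q ->
  trace_norm (P - Q) <= complex.Re (\tr P) + complex.Re (\tr Q).
Proof.
move=> pP pQ; have [A dA] : {A | A = P - Q} by exists (P - Q).
have hA : A^t* = A by rewrite dA linearB /= map_mxB (proj1 pP) (proj1 pQ).
have /hermsymmxP hermA := hA.
have /orthomx_spectralP := hermitian_normalmx hermA.
have := hermitian_spectral_diag_real hermA; have := spectral_unitarymx A.
rewrite -dA; move: (spectralmx A) (spectral_diag A) => V d uV realD eA.
have VV : V *m V^t* = 1%:M by exact/unitarymxP.
(* Since [A] is Hermitian, its singular values are the absolute values of its eigenvalues. *)
have eAA : A^t* *m A = invmx V *m diag_mx (\row_i d 0 i ^+ 2) *m V.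
  by rewrite hA eA; exact: conj_diag_mx_sqr (unitarymx_unit uV).
rewrite /trace_norm.
rewrite (sum_spectral_diag (fun z => Num.sqrt (complex.Re z)) uV eAA).
have trV (B : 'M[R[i]]_n) : \tr B = \tr (V *m B *m V^t*).
  by rewrite mxtrace_mulC mulmxA (mulmx1C VV) mul1mx.
rewrite (trV P) (trV Q) /mxtrace !raddf_sum -big_split /=.
apply: ler_sum => i _; rewrite mxE.
have dE : d 0 i = (V *m P *m V^t*) i i - (V *m Q *m V^t*) i i.
  transitivity ((V *m A *m V^t*) i i); last by rewrite dA mulmxBr mulmxBl !mxE.
  rewrite eA !mulmxA mulmxV ?unitarymx_unit // mul1mx -mulmxA VV mulmx1.
  by rewrite !mxE eqxx.
(* The eigenvalues are real, so squaring commutes with taking the real part. *)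
have dR : complex.Im (d 0 i) = 0.
  by have /mxOverP/(_ 0 i)/complex_realP[x ->] := realD.
have Re_sqr : complex.Re (d 0 i ^+ 2) = complex.Re (d 0 i) ^+ 2.
  by move: dR; case: (d 0 i) => x y /= ->; rewrite mulr0 subr0.
rewrite Re_sqr sqrtr_sqr dE raddfB /= (le_trans (ler_normB _ _)) //.
by rewrite !ger0_norm ?Re_ge0 //; apply/psdmx_diag_ge0/psdmx_conj.
Qed.

(** * Tensor products of linear maps *)

(** The fourfold sum has the shape of [tens_map], so that identities about [tens_map] can be checked
    term by term on matrix units. *)
Lemma matrix_sum_tens_delta (C : comPzRingType) m n (X : 'M[C]_(m * n)) :
  X = \sum_(i < m) \sum_(j < m) \sum_(k < n) \sum_(l < n)
    X (mxtens_index (i, k)) (mxtens_index (j, l)) *: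
      (delta_mx i j *t delta_mx k l).
Proof.
apply/matrixP => a b; case: (mxtens_indexP a) => i k; case: (mxtens_indexP b) => j l.
rewrite summxE (bigD1 i) //= [X in _ + X]big1 ?addr0; last first.
  move=> i' ne; rewrite summxE big1 // => j' _; rewrite summxE big1 // => k' _.
  rewrite summxE big1 // => l' _; rewrite mxE tensmxE !mxE.
  by rewrite [i == _]eq_sym (negPf ne) mul0r mulr0.
rewrite summxE (bigD1 j) //= [X in _ + X]big1 ?addr0; last first.
  move=> j' ne; rewrite summxE big1 // => k' _.
  rewrite summxE big1 // => l' _; rewrite mxE tensmxE !mxE.
  by rewrite [j == _]eq_sym (negPf ne) andbF mul0r mulr0.
rewrite summxE (bigD1 k) //= [X in _ + X]big1 ?addr0; last first.
  move=> k' ne; rewrite summxE big1 // => l' _; rewrite mxE tensmxE !mxE.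
  by rewrite [k == _]eq_sym (negPf ne) mulr0 mulr0.
rewrite summxE (bigD1 l) //= [X in _ + X]big1 ?addr0; last first.
  move=> l' ne; rewrite mxE tensmxE !mxE.
  by rewrite [l == _]eq_sym (negPf ne) andbF mulr0 mulr0.
by rewrite mxE tensmxE !mxE !eqxx !mulr1.
Qed.

Lemma tensmxDl (C : pzRingType) m n p q (A B : 'M[C]_(m, n)) (D : 'M_(p, q)) :
  (A + B) *t D = A *t D + B *t D.
Proof. by apply/matrixP => i j; rewrite !mxE mulrDl. Qed.

Lemma tensmxZl (C : pzRingType) m n p q c (A : 'M[C]_(m, n)) (D : 'M_(p, q)) :
  (c *: A) *t D = c *: (A *t D).
Proof. by apply/matrixP => i j; rewrite !mxE mulrA. Qed.

Lemma tensmx_suml (C : pzRingType) m n p q (I : finType) (A : I -> 'M[C]_(m, n))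
    (D : 'M_(p, q)) : (\sum_i A i) *t D = \sum_i (A i *t D).
Proof.
by apply: (big_morph (fun A => A *t D)) => [A1 A2|]; rewrite ?tens0mx ?tensmxDl.
Qed.

Section TensMap.
Variable R : realType.
Local Notation C := R[i].

Lemma tens_mapZB m n (E E1 E2 : {linear 'M[C]_m -> 'M[C]_m})
    (F : {linear 'M[C]_n -> 'M[C]_n}) c (X : 'M_(m * n)) :
  (forall Y, E Y = c *: (E1 Y - E2 Y)) ->
  tens_map E F X = c *: (tens_map E1 F X - tens_map E2 F X).
Proof.
move=> dE; rewrite /tens_map -sumrB scaler_sumr; apply: eq_bigr => i _.
rewrite -sumrB scaler_sumr; apply: eq_bigr => j _.
rewrite -sumrB scaler_sumr; apply: eq_bigr => k _.
rewrite -sumrB scaler_sumr; apply: eq_bigr => l _.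
rewrite dE tensmxZl -scaleN1r tensmxDl tensmxZl scaleN1r -scalerBr.
by rewrite !scalerA mulrC.
Qed.

Lemma mxtrace_tens_map m n (E : {linear 'M[C]_m -> 'M[C]_m})
    (F : {linear 'M[C]_n -> 'M[C]_n}) (X : 'M_(m * n)) :
  (forall Y, \tr (E Y) = \tr Y) -> (forall Y, \tr (F Y) = \tr Y) ->
  \tr (tens_map E F X) = \tr X.
Proof.
move=> trE trF; rewrite [in RHS](matrix_sum_tens_delta X) /tens_map.
rewrite !raddf_sum; apply: eq_bigr => i _; rewrite !raddf_sum.
apply: eq_bigr => j _; rewrite !raddf_sum; apply: eq_bigr => k _.
rewrite !raddf_sum; apply: eq_bigr => l _.
by rewrite /= !mxtraceZ !mxtrace_tens trE trF.
Qed.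

(** This is the characteristic property of the tensor product of maps; bilinearity carries it from
    matrix units to all pairs. *)
Lemma tens_map_tens m n (E : {linear 'M[C]_m -> 'M[C]_m})
    (F : {linear 'M[C]_n -> 'M[C]_n}) (A : 'M_m) (B : 'M_n) :
  tens_map E F (A *t B) = E A *t F B.
Proof.
rewrite /tens_map [in RHS](matrix_sum_delta A) linear_sum tensmx_suml.
apply: eq_bigr => i _; rewrite linear_sum tensmx_suml.
apply: eq_bigr => j _; rewrite linearZ tensmxZl.
rewrite [in RHS](matrix_sum_delta B) linear_sum.
have tensr : forall (I : finType) (G : I -> 'M[C]_n) (D : 'M[C]_m),
    D *t (\sum_x G x) = \sum_x (D *t G x).
  move=> I G D; apply: (big_morph (fun A => D *t A)) => [A1 A2|].
    by apply/matrixP => x y; rewrite !mxE mulrDr.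
  by rewrite tensmx0.
rewrite tensr scaler_sumr; apply: eq_bigr => k _.
rewrite linear_sum tensr scaler_sumr; apply: eq_bigr => l _.
rewrite tensmxE linearZ -scalerA; congr (_ *: _).
by apply/matrixP => x y; rewrite !mxE mulrCA.
Qed.

(** On a tensor of matrix units, the mixed product rule turns each Kraus operator [K a] of [E] into
    [K a *t 1%:M]. *)
Lemma tens_map_kraus m n (E : {linear 'M[C]_m -> 'M[C]_m}) (I : finType)
    (K : I -> 'M[C]_m) c (X : 'M_(m * n)) :
  (forall Y, E Y = c *: \sum_a (K a *m Y *m (K a)^t*)) ->
  tens_map E idfun X =
    c *: \sum_a ((K a *t 1%:M) *m X *m (K a *t 1%:M)^t*).
Proof.
move=> dE; rewrite [in RHS](matrix_sum_tens_delta X).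
under [in RHS]eq_bigr => a _ do rewrite mulmx_sumr mulmx_suml.
rewrite [in RHS]exchange_big /= scaler_sumr; apply: eq_bigr => i _.
under [in RHS]eq_bigr => a _ do rewrite mulmx_sumr mulmx_suml.
rewrite [in RHS]exchange_big /= scaler_sumr; apply: eq_bigr => j _.
under [in RHS]eq_bigr => a _ do rewrite mulmx_sumr mulmx_suml.
rewrite [in RHS]exchange_big /= scaler_sumr; apply: eq_bigr => k _.
under [in RHS]eq_bigr => a _ do rewrite mulmx_sumr mulmx_suml.
rewrite [in RHS]exchange_big /= scaler_sumr; apply: eq_bigr => l _.
rewrite dE tensmxZl tensmx_suml scalerA mulrC -scalerA scaler_sumr; congr (_ *: _).
apply: eq_bigr => a _; rewrite trmxC_tens -scalemxAr -scalemxAl !tensmx_mul.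
by rewrite mul1mx trmx1 map_mx1 mulmx1.
Qed.

(** A map in Kraus form is completely positive: conjugations and nonnegative combinations preserve
    positivity. *)
Lemma psdmx_tens_map_kraus m n (E : {linear 'M[C]_m -> 'M[C]_m}) (I : finType)
    (K : I -> 'M[C]_m) c (X : 'M_(m * n)) :
  0 <= c -> (forall Y, E Y = c *: \sum_a (K a *m Y *m (K a)^t*)) ->
  psdmx X -> psdmx (tens_map E idfun X).
Proof.
move=> c0 dE pX; rewrite (tens_map_kraus X dE).
exact: psdmxZ c0 (psdmx_sum (fun a => psdmx_conj (K a *t 1%:M) pX)).
Qed.

End TensMap.

(** * Scaling of suprema, basis states and orthogonal projections *)

Lemma mxtrace_delta (C : pzRingType) m (i : 'I_m) :
  \tr (delta_mx i i : 'M[C]_m) = 1.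
Proof.
rewrite /mxtrace (bigD1 i) //= big1 ?addr0 => [|j ne]; first by rewrite mxE !eqxx.
by rewrite mxE (negPf ne).
Qed.

Lemma sup_ge0 (R : realType) (S : set R) : (forall x, S x -> 0 <= x) -> 0 <= sup S.
Proof.
move=> S0; have [[ [x Sx] ubS]|/sup_out ->//] := pselect (has_sup S).
by apply: le_trans (S0 x Sx) _; exact: ub_le_sup.
Qed.

Lemma sup_imageZ (R : realType) (T : Type) (A : set T) (f : T -> R) (t : R) :
  0 <= t -> nonempty A -> has_ubound (f @` A)%classic ->
  sup [set t * f x | x in A] = t * sup (f @` A)%classic.
Proof.
move=> t0 [a Aa] ubf; have fA x : A x -> f x <= sup (f @` A)%classic.
  by move=> Ax; apply: ub_le_sup => //; exists x.
have tfA x : A x -> t * f x <= sup [set t * f x | x in A].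
  move=> Ax; apply: ub_le_sup; last by exists x.
  by exists (t * sup (f @` A)%classic) => _ [y Ay <-]; rewrite ler_wpM2l ?fA.
apply/eqP; rewrite eq_le; apply/andP; split.
  apply: sup_le_ub; first by exists (t * f a), a.
  by move=> _ [y Ay <-]; rewrite ler_wpM2l ?fA.
(* Division by [t] is excluded here, but the scaled set contains [t * f a], which is 0. *)
have [te0|tn0] := eqVneq t 0.
  by rewrite {1}te0 mul0r -(mul0r (f a)) -te0 tfA.
have tp : 0 < t by rewrite lt_neqAle eq_sym tn0.
rewrite mulrC -ler_pdivlMr //; apply: sup_le_ub; first by exists (f a), a.
by move=> _ [y Ay <-]; rewrite ler_pdivlMr // mulrC tfA.
Qed.

(** The matrix is the projection onto a product basis vector, hence a Gram matrix of trace 1. *)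
Lemma density_tens_delta (R : realType) m n (i : 'I_m) (k : 'I_n) :
  density_matrix (delta_mx i i *t delta_mx k k : 'M[R[i]]_(m * n)).
Proof.
have -> : delta_mx i i *t delta_mx k k =
    (delta_mx i 0 *t delta_mx k 0 : 'M[R[i]]_(m * n, 1 * 1)) *m
    (delta_mx i 0 *t delta_mx k 0)^t*.
  by rewrite trmxC_tens !trmxC_delta tensmx_mul !mul_delta_mx.
have [hA pA] := psdmx_gram (delta_mx i 0 *t delta_mx k 0 : 'M[R[i]]_(m * n, 1 * 1)).
split=> //; first exact/hermsymmxP.
rewrite trmxC_tens !trmxC_delta tensmx_mul !mul_delta_mx mxtrace_tens.
by rewrite !mxtrace_delta mulr1.
Qed.

Lemma mul_delta_mx_delta (C : comPzRingType) m n p q (A : 'M[C]_(n, p))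
    (i : 'I_m) j k (l : 'I_q) :
  delta_mx i j *m A *m delta_mx k l = A j k *: delta_mx i l.
Proof.
rewrite -(mul_delta_mx (0 : 'I_1) i j) -(mul_delta_mx (0 : 'I_1) k l).
rewrite !mulmxA -2!(mulmxA (delta_mx i 0)) -rowE -colE.
by rewrite [col _ _]mx11_scalar !mxE mul_mx_scalar -scalemxAl mul_delta_mx.
Qed.

Lemma sqr_euclidean_norm (R : realType) m (v : 'cV[R[i]]_m) :
  (euclidean_norm v ^+ 2)%:C = (v^t* *m v) 0 0.
Proof.
rewrite sqr_sqrtr; last by apply: sumr_ge0 => i _; exact: sqr_ge0.
rewrite rmorph_sum mxE; apply: eq_bigr => i _; rewrite !mxE mulrC rmorphXn /=.
exact: sqr_normc.
Qed.

(** The cross terms vanish because [P] is an orthogonal projection. *)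
Lemma proj_pythagoras (C : numClosedFieldType) m (P : 'M[C]_m) (v : 'cV_m) :
  P^t* = P -> P *m P = P ->
  v^t* *m v = (P *m v)^t* *m (P *m v) + (v - P *m v)^t* *m (v - P *m v).
Proof.
move=> hP PP; have -> : (v - P *m v)^t* = v^t* - v^t* *m P.
  by rewrite linearB /= map_mxB trmxC_mul hP.
rewrite trmxC_mul hP mulmxBl !mulmxBr !mulmxA -(mulmxA _ P P) PP.
by rewrite subrr subr0 addrC subrK.
Qed.

Lemma operator_norm_proj (R : realType) m (P : 'M[R[i]]_m) :
  P^t* = P -> P *m P = P -> operator_norm P <= 1.
Proof.
move=> hP PP; apply: sup_le => // _ [v v1 <-].
have nP0 : 0 <= euclidean_norm (P *m v) by exact: sqrtr_ge0.
rewrite -(@ler_pXn2r _ 2) ?nnegrE // -v1 -lecR !sqr_euclidean_norm.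
rewrite (proj_pythagoras v hP PP).
by rewrite [leRHS]mxE lerDl -sqr_euclidean_norm ler0c sqr_ge0.
Qed.

(** * The noisy channel and its distance to the noiseless one *)

Section Depolarizing.
Variables (R : realType) (m : nat) (U : 'M[R[i]]_m).
Hypothesis uU : U \is unitarymx.
Hypothesis m0 : (0 < m)%N.
Local Notation C := R[i].

Let UU : U^t* *m U = 1%:M.
Proof. by apply: mulmx1C; exact/unitarymxP. Qed.

Lemma mxtrace_unitary_channel X : \tr (unitary_channel U X) = \tr X.
Proof. by rewrite /unitary_channel mxtrace_mulC mulmxA UU mul1mx. Qed.

Lemma noisy_channelE (gamma : R) X : noisy_channel gamma U X =
  (1 - gamma)%:C *: unitary_channel U X + (gamma%:C * \tr X / m%:R)%:M.
Proof.
rewrite /noisy_channel /= /depolarizing mxtrace_unitary_channel.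
by rewrite scalerA scalemx1.
Qed.

Lemma mxtrace_noisy_channel (gamma : R) X :
  \tr (noisy_channel gamma U X) = \tr X.
Proof.
rewrite noisy_channelE mxtraceD mxtraceZ mxtrace_unitary_channel mxtrace_scalar.
rewrite -[_ *+ m]mulr_natr divfK ?pnatr_eq0 -?lt0n // -mulrDl -rmorphD subrK.
by rewrite mul1r.
Qed.

(** At full strength the output is the trace times the maximally mixed state. Conjugating [Y] by the
    matrix unit at [(i, j)] gives [Y j j *: delta_mx i i]; summing over [j] produces the trace and
    over [i] the identity. *)
Lemma noisy_channel1_kraus X : noisy_channel 1 U X = m%:R^-1 *:
  \sum_(a : 'I_m * 'I_m)
    ((delta_mx a.1 a.2 *m U) *m X *m (delta_mx a.1 a.2 *m U)^t*).
Proof.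
rewrite noisy_channelE subrr scale0r add0r mul1r mulrC -scale_scalar_mx.
congr (_ *: _).
transitivity (\sum_(a : 'I_m * 'I_m)
    (unitary_channel U X a.2 a.2 *: (delta_mx a.1 a.1 : 'M[C]_m))).
  rewrite -(pair_bigA _ (fun i j => unitary_channel U X j j *:
    (delta_mx i i : 'M[C]_m))) /=.
  under eq_bigr do rewrite -scaler_suml -/(mxtrace _) mxtrace_unitary_channel.
  rewrite -scaler_sumr -scalemx1; congr (_ *: _).
  apply/matrixP => i j; rewrite summxE (bigD1 i) //= big1 ?addr0.
    by rewrite !mxE (eqxx i) eq_sym.
  by move=> k ne; rewrite mxE [i == k]eq_sym (negPf ne).
apply: eq_bigr => -[i j] _ /=; rewrite trmxC_mul trmxC_delta.
have -> : delta_mx i j *m U *m X *m (U^t* *m delta_mx j i) =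
  delta_mx i j *m unitary_channel U X *m delta_mx j i by rewrite !mulmxA.
by rewrite mul_delta_mx_delta.
Qed.

(** The noisy channel is affine in [gamma] and noiseless at 0, so the difference is [gamma] times
    its value at strength 1. *)
Lemma tens_map_noise (gamma : R) n (X : 'M[C]_(m * n)) :
  tens_map (unitary_channel U \- noisy_channel gamma U) idfun X = gamma%:C *:
    (tens_map (unitary_channel U) idfun X - tens_map (noisy_channel 1 U) idfun X).
Proof.
apply: tens_mapZB => Y.
rewrite -[LHS]/(unitary_channel U Y - noisy_channel gamma U Y).
rewrite !noisy_channelE subrr scale0r add0r mul1r.
rewrite rmorphB /= scalerBl scale1r opprD opprB addrA addrCA addrN addr0.
by rewrite scalerBr -mulrA -scale_scalar_mx.
Qed.

(** Both channels are completely positive and trace preserving, so this is a difference of two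
    positive matrices of trace 1. *)
Lemma trace_norm_noise_le2 (rho : 'M[C]_(m * m)) : density_matrix rho ->
  trace_norm (tens_map (unitary_channel U) idfun rho
    - tens_map (noisy_channel 1 U) idfun rho) <= 2.
Proof.
move=> [/hermsymmxP hr pr tr1].
have psd_rho : psdmx rho by [].
apply: le_trans (trace_norm_psdB _ _) _.
(* The unitary channel has the single Kraus operator [U], indexed by [unit]. *)
- apply: (@psdmx_tens_map_kraus _ _ _ _ unit (fun=> U) 1) psd_rho => // Y.
  by rewrite big_const card_unit /= addr0 scale1r.
- apply: psdmx_tens_map_kraus noisy_channel1_kraus psd_rho.
  by rewrite invr_ge0 ler0n.
rewrite !mxtrace_tens_map ?tr1 //.
  exact: mxtrace_noisy_channel.
exact: mxtrace_unitary_channel.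
Qed.

Lemma diamond_norm_noise (gamma : R) : 0 <= gamma ->
  diamond_norm (unitary_channel U \- noisy_channel gamma U) =
  gamma * diamond_norm (unitary_channel U \- noisy_channel 1 U).
Proof.
move=> g0; pose T (rho : 'M[C]_(m * m)) := trace_norm
  (tens_map (unitary_channel U) idfun rho - tens_map (noisy_channel 1 U) idfun rho).
have TE t : 0 <= t -> diamond_norm (unitary_channel U \- noisy_channel t U) =
    sup [set t * T rho | rho in [set rho | density_matrix rho]].
  move=> t0; congr sup; apply: eq_imagel => rho _.
  by rewrite tens_map_noise trace_normZ.
rewrite !TE //; under [in RHS]eq_imagel do rewrite mul1r.
(* Pulling [gamma] out of the supremum requires a nonempty bounded set: a basis state and the bound
   2 provide this. *)
have Tne : nonempty [set rho : 'M[C]_(m * m) | density_matrix rho].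
  by eexists; exact: (density_tens_delta R (Ordinal m0) (Ordinal m0)).
rewrite sup_imageZ //; exists 2 => _ [rho drho <-]; exact: trace_norm_noise_le2.
Qed.

Lemma diamond_norm_noise1_bounds :
  0 <= diamond_norm (unitary_channel U \- noisy_channel 1 U) <= 2.
Proof.
apply/andP; split; last first.
  apply: sup_le => // _ [rho drho <-]; rewrite tens_map_noise trace_normZ // mul1r.
  exact: trace_norm_noise_le2.
apply: sup_ge0 => _ [rho drho <-]; apply: sumr_ge0 => i _; exact: sqrtr_ge0.
Qed.

Lemma unitary_channel_delta_idem (i : 'I_m) :
  let P := unitary_channel U (delta_mx i i) in P *m P = P.
Proof.
rewrite /= /unitary_channel -!mulmxA (mulmxA (U^t*)) UU mul1mx !mulmxA.
by rewrite -(mulmxA U) mul_delta_mx.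
Qed.

(** One copy contributes [(1 - gamma) + gamma / m], since [P] is idempotent of trace 1. State and
    observable are both products, so two copies give the square. *)
Lemma mxtrace_query (gamma : R) (i : 'I_m) :
  let P := unitary_channel U (delta_mx i i) in
  \tr ((P *t P) *m tens_map (noisy_channel gamma U) (noisy_channel gamma U)
         (delta_mx i i *t delta_mx i i)) =
  ((1 - gamma * (1 - m%:R^-1)) ^+ 2)%:C.
Proof.
move=> P; have trP : \tr P = 1.
  by rewrite mxtrace_unitary_channel mxtrace_delta.
have PP : P *m P = P := unitary_channel_delta_idem i.
rewrite tens_map_tens tensmx_mul mxtrace_tens -expr2 [RHS]rmorphXn; congr (_ ^+ 2).
rewrite noisy_channelE -/P mulmxDr -scalemxAr PP mul_mx_scalar.
rewrite mxtraceD !mxtraceZ trP mxtrace_delta !mulr1.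
rewrite -(rmorph_nat (real_complex R)) -fmorphV -rmorphM -rmorphD.
by congr (_%:C); ring.
Qed.

End Depolarizing.

(** In dimension 1 a matrix is determined by its trace, so both channels agree. *)
Lemma diamond_norm_noise_dim1 (R : realType) (U : 'M[R[i]]_1) : U \is unitarymx ->
  diamond_norm (unitary_channel U \- noisy_channel 1 U) = 0.
Proof.
move=> uU; apply/eqP; rewrite eq_le.
have /andP[-> _] := diamond_norm_noise1_bounds uU isT; rewrite andbT.
apply: sup_le => // _ [rho _ <-].
rewrite (@tens_mapZB _ _ _ _ (unitary_channel U) (noisy_channel 1 U) idfun 0).
  by rewrite -[0]/((0 : R)%:C) trace_normZ // mul0r.
move=> Y; rewrite scale0r -[LHS]/(unitary_channel U Y - noisy_channel 1 U Y).
rewrite noisy_channelE // subrr scale0r add0r mul1r invr1 mulr1.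
rewrite -(mxtrace_unitary_channel uU) [unitary_channel U Y]mx11_scalar.
by rewrite mxtrace_scalar mulr1n subrr.
Qed.

(** * Recovering the noise from one answer *)

(** As [x ^+ 2] is at least [g ^+ 2], raising [alpha] to that level preserves the error bound [t].
    With [s] the resulting root, [x ^+ 2 - s ^+ 2] factors as [(x - s) * (x + s)], where [x + s] is
    at least [2 * g]. *)
Lemma sqrt_estimate (R : rcfType) (g x t alpha : R) :
  0 < g -> g <= x -> `|alpha - x ^+ 2| <= t ->
  `|x - Num.sqrt (Num.max alpha (g ^+ 2))| <= t / (2 * g).
Proof.
move=> g0 gx; set s := Num.sqrt _ => ax.
have g2 : 0 <= g ^+ 2 by rewrite sqr_ge0.
have m0 : 0 <= Num.max alpha (g ^+ 2) by rewrite le_max g2 orbT.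
have gs : g <= s.
  by rewrite -(ler_pXn2r (n := 2)) ?nnegrE ?sqrtr_ge0 ?(ltW g0) // sqr_sqrtr // le_max lexx orbT.
have xx : `|x ^+ 2 - s ^+ 2| <= t.
  have gx2 : g ^+ 2 <= x ^+ 2 by rewrite ler_pXn2r ?nnegrE ?(ltW g0) // (le_trans (ltW g0)).
  rewrite sqr_sqrtr // maxEle; move: ax; rewrite !ler_norml => /andP[ax1 ax2].
  by apply/andP; case: (leP alpha (g ^+ 2)) => ag; split; lra.
rewrite ler_pdivlMr ?mulr_gt0 //; apply: le_trans xx.
have -> : x ^+ 2 - s ^+ 2 = (x - s) * (x + s) by ring.
rewrite normrM ler_wpM2l // ger0_norm; first lra.
by rewrite addr_ge0 ?(le_trans (ltW g0)).
Qed.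

Theorem theorem2 (R : realType) :
  exists c1 c2 : R, 0 < c1 /\ 0 < c2 /\
  forall (n : nat) (U : 'M[R[i]]_(2 ^ n)), U \is unitarymx ->
  forall gamma_u epsilon : R, 0 < epsilon -> epsilon <= 1 - gamma_u ->
  exists (O rho : 'M[R[i]]_(2 ^ n * 2 ^ n)) (tau : R) (l u : R -> R),
    admissible_query O rho tau /\
    c1 * ((1 - gamma_u) * epsilon) <= tau <= c2 * ((1 - gamma_u) * epsilon) /\
    forall gamma : R, 0 <= gamma <= 1 -> gamma <= gamma_u ->
    forall alpha : R, qpstat2 (noisy_channel gamma U) O rho tau alpha ->
      l alpha <= diamond_norm (unitary_channel U \- noisy_channel gamma U)
        <= u alpha /\
      u alpha - l alpha <= epsilon.
Proof.
have q0 : 0 < 4%:R^-1 :> R by rewrite invr_gt0 ltr0n.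
(* The constants coincide because the tolerance is exactly [(1 - gamma_u) * epsilon / 4]. *)
exists 4%:R^-1, 4%:R^-1; do 2 split=> //.
move=> n U uU gamma_u epsilon e0 eg.
have m0 : (0 < 2 ^ n)%N by rewrite expn_gt0.
pose i := Ordinal m0; pose P := unitary_channel U (delta_mx i i).
pose g := 1 - gamma_u; have g0 : 0 < g := lt_le_trans e0 eg.
pose c : R := 1 - (2 ^ n)%:R^-1.
pose D := diamond_norm (unitary_channel U \- noisy_channel 1 U).
(* The square root estimates [1 - gamma * c]; solving for [gamma] and multiplying by [D] estimates
   the diamond distance. *)
pose est (alpha : R) := D * ((1 - Num.sqrt (Num.max alpha (g ^+ 2))) / c).
(* For n = 0 we have c = 0, so [est] divides by 0; this is harmless as D = 0. *)
exists (P *t P), (delta_mx i i *t delta_mx i i), (4%:R^-1 * (g * epsilon)),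
  (fun alpha => est alpha - epsilon / 2), (fun alpha => est alpha + epsilon / 2).
have t0 : 0 < 4%:R^-1 * (g * epsilon) by rewrite !mulr_gt0.
split.
  have hP : P^t* = P.
    by rewrite /P /unitary_channel !trmxC_mul trmxCK trmxC_delta mulmxA.
  have PP : P *m P = P := unitary_channel_delta_idem uU i.
  split=> //; last exact: density_tens_delta.
    by apply/hermsymmxP; rewrite trmxC_tens hP.
  by apply: operator_norm_proj; rewrite ?trmxC_tens ?hP // tensmx_mul PP.
split; first by rewrite lexx.
move=> gamma /andP[gam0 gam1] gamu alpha.
(* The expectation is real, so the complex modulus becomes a real absolute value. *)
rewrite /qpstat2 mxtrace_query // -/c -rmorphB normc_def /= expr0n addr0 sqrtr_sqr.
rewrite lecR => alpha_close.
split; last by lra.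
rewrite diamond_norm_noise // -/D -ler_distl.
have [c0 c1] : 0 <= c /\ c <= 1.
  by rewrite subr_ge0 invf_le1 ?ltr0n // ler1n m0 gerBl invr_ge0 ler0n.
have gx : g <= 1 - gamma * c by rewrite /g; nra.
rewrite /est; set s := Num.sqrt _.
(* The tolerance divided by [2 * g] is [epsilon / 8]. *)
have xs : `|1 - gamma * c - s| <= epsilon / 8%:R.
  apply: le_trans (sqrt_estimate g0 gx alpha_close) _.
  move: (g) g0 => h h0; rewrite le_eqVlt; apply/orP; left; apply/eqP.
  by field; apply/lt0r_neq0.
have [n0|n_gt0] := posnP n.
  have -> : D = 0 by rewrite /D; subst n; exact: diamond_norm_noise_dim1.
  by rewrite mulr0 mul0r subrr normr0; lra.
(* From one qubit on the dimension is at least 2, so dividing by [c] at most doubles the error. *)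
have c_half : 1 <= 2 * c.
  have : (2 ^ n)%:R^-1 <= 2^-1 :> R.
    rewrite lef_pV2 ?posrE ?ltr0n // ler_nat -[X in (X <= _)%N]expn1.
    by rewrite leq_exp2l.
  by rewrite /c; lra.
have cp : 0 < c by lra.
have /andP[D0 D2] := diamond_norm_noise1_bounds uU m0.
have -> : gamma * D - D * ((1 - s) / c) = - (D * (1 - gamma * c - s) / c).
  by move: (c) (D) (s) cp => c' D' s' /lt0r_neq0 c'0; field.
rewrite normrN !normrM normfV (ger0_norm D0) (gtr0_norm cp) ler_pdivrMr //.
(* With [D] at most 2 and [c] at least 1/2, the error [epsilon / 8] grows at most to [epsilon / 2],
   the half-width of the interval. *)
apply: le_trans (_ : 2 * (epsilon / 8%:R) <= _); first exact: ler_pM.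
by nra.
Qed.
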